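(* Every Pisot number $q \in (1,2)$ of degree at most $150$ satisfies $|q'| \geq \frac{\sqrt5-1}{2}$ for all Galois conjugates $q'$ of $q$.
   Context: A Pisot number is a real algebraic integer $q>1$ all of whose other Galois conjugates have absolute value strictly less than $1$. *)

(* Defs.v *)
From HB Require Import structures.
From mathcomp Require Import all_boot all_order all_algebra all_field.
Set Implicit Arguments. Unset Strict Implicit. Unset Printing Implicit Defensive.
Import Order.TTheory GRing.Theory Num.Theory.
Local Open Scope ring_scope.

Definition galois_conjugate (q z : algC) : bool := root (minCpoly q) z.

Definition alg_degree (q : algC) : nat := (size (minCpoly q)).-1.

Definition pisot (q : algC) : Prop :=
  [/\ q \is Num.real, q \in Aint, 1 < q &
      forall z : algC, galois_conjugate q z -> z != q -> `|z| < 1].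

(* Main.v *)
Require Import Defs.
From HB Require Import structures.
From mathcomp Require Import all_boot all_order all_algebra all_field.
From mathcomp Require Import ring lra zify.
Import Order.TTheory GRing.Theory Num.Theory.
Local Open Scope ring_scope.

(* The norm of q is a nonzero integer of modulus less
   than 2, so q is a unit and T := \sum_a (a^* - a^-1), over all conjugates a,
   is an integer. Suppose that s is a conjugate with |s| < c := (sqrt 5 - 1) / 2.
   If s is not real, then s^* is a further conjugate and 1 <= q |s|^2 < 2 c^2 < 1.
   If s is real, the conjugates other than q and s have moduli of product 1 / t
   with t := q |s|, and contribute to T at most t - 1 / t in absolute value, as
   u |-> 1 / u - u is superadditive under multiplication on ]0, 1]. Hence
   2 < T < 3 if s < 0, and 0 < T < 1 if s > 0 and t > 1. Finally, if s > 0 and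
   t = 1, then q and s are the only conjugates, and 2 < q + s < 3. *)

(** * Inequalities that place T strictly between consecutive integers *)

(* The inverses xi and si are variables so that the statement transfers to algC
   through algR by conversion. *)
Lemma negative_window (F : realFieldType) (c x xi s si r : F) :
  0 < c -> c ^+ 2 + c = 1 -> x < 2 -> x * xi = 1 -> 0 < s -> s * si = 1 ->
  s < c -> 1 <= x * s -> `|r| <= x * s - xi * si ->
  2 < x - xi - s + si + r < 3.
Proof.
move=> c0 hc x2 xxi s0 ssi sc t1; rewrite ler_norml => /andP [rl ru].
have x0 : 0 < x by nra.
have xi0 : 0 < xi by nra.
have si0 : 0 < si by nra.
have t0 : 0 < x * s by lra.
(* With t = x s, multiplication by t clears denominators, and the values at the two extremes r = -(t
   - 1/t) and r = t - 1/t factor. *)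
have lo : (x * s) * (x - xi - s + si - (x * s - xi * si)) =
          (x * s + 1) * (x * s + s) * (si - 1).
  ring: xxi ssi.
have up : (x * s) * (x - xi - s + si + (x * s - xi * si)) =
          (x * s + 1) * (x - 1) * (1 + s).
  ring: xxi ssi.
(* 1/c = 1 + c. *)
have sic : c < si - 1 by nra.
have L : 2 * (x * s) < (x * s + 1) * (x * s + s) * (si - 1).
  have e : (x * s + s) * (si - 1) = x * s * (si - 1) + (1 - s) by ring: ssi.
  rewrite -mulrA e.
  have e1 : x * s * c < x * s * (si - 1) by rewrite ltr_pM2l.
  (* This product is (t + 1) (c t + 1 - c) - 2 t, and its second factor is nonnegative because t >=
     1 and c > 1/2. *)
  have e2 : 0 <= (x * s - 1) * (c * (x * s) - (1 - c)).
    by rewrite mulr_ge0 ?subr_ge0 //; nra.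
  nra.
have U : (x * s + 1) * (x - 1) * (1 + s) < 3 * (x * s).
  have s1 : s < 1 by nra.
  have t2 : x * s < 2 by nra.
  (* Expanding gives x < 2 + s - t / 2, which removes x in favour of t. The remaining quadratic
     inequality in t is (t - 1) (2 - t) >= 0. *)
  have e1 : 0 < (2 - x) * (2 + s) by apply: mulr_gt0; lra.
  have e2 : (x - 1) * (1 + s) < 1 + x * s / 2 by lra.
  have e4 : (x * s + 1) * ((x - 1) * (1 + s)) < (x * s + 1) * (1 + x * s / 2).
    by rewrite ltr_pM2l //; lra.
  have e3 : 0 <= (x * s - 1) * (2 - x * s) by apply: mulr_ge0; lra.
  rewrite -mulrA; apply: lt_le_trans e4 _; lra.
apply/andP; split; rewrite -(ltr_pM2l t0).
  apply: (@lt_le_trans _ _ (x * s * (x - xi - s + si - (x * s - xi * si)))).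
    by rewrite lo; lra.
  by rewrite ler_pM2l //; lra.
apply: (@le_lt_trans _ _ (x * s * (x - xi - s + si + (x * s - xi * si)))).
  by rewrite ler_pM2l //; lra.
by rewrite up; lra.
Qed.

(** Both extremes now carry the factor t - 1, so the lower bound is strict only for t > 1. *)
Lemma positive_window (F : realFieldType) (c x xi s si r : F) :
  0 < c -> c ^+ 2 + c = 1 -> x < 2 -> x * xi = 1 -> 0 < s -> s * si = 1 ->
  s < c -> 1 < x * s -> `|r| <= x * s - xi * si ->
  0 < x - xi + s - si + r < 1.
Proof.
move=> c0 hc x2 xxi s0 ssi sc t1; rewrite ler_norml => /andP [rl ru].
have x0 : 0 < x by nra.
have t0 : 0 < x * s by lra.
have lo : (x * s) * (x - xi + s - si - (x * s - xi * si)) =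
          (x * s - 1) * (x - 1) * (1 - s).
  ring: xxi ssi.
have up : (x * s) * (x - xi + s - si + (x * s - xi * si)) =
          (x * s - 1) * (x + 1) * (1 + s).
  ring: xxi ssi.
(* The rational bound is sharp enough: it gives t < 5/4, while 3 (13/8) (t - 1) < t holds for all t
   < 39/31. *)
have c58 : c < 5 / 8 by nra.
have L : 0 < (x * s - 1) * (x - 1) * (1 - s).
  by rewrite !mulr_gt0 // subr_gt0; nra.
have U : (x * s - 1) * (x + 1) * (1 + s) < x * s.
  have : (x + 1) * (1 + s) <= 3 * (13 / 8) by nra.
  have : x * s < 5 / 4 by nra.
  rewrite -mulrA => u v.
  have : (x * s - 1) * ((x + 1) * (1 + s)) <= (x * s - 1) * (3 * (13 / 8)).
    by rewrite ler_pM2l //; lra.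
  lra.
apply/andP; split; rewrite -(ltr_pM2l t0).
  apply: (@lt_le_trans _ _ (x * s * (x - xi + s - si - (x * s - xi * si)))).
    by rewrite lo; lra.
  by rewrite ler_pM2l //; lra.
apply: (@le_lt_trans _ _ (x * s * (x - xi + s - si + (x * s - xi * si)))).
  by rewrite ler_pM2l //; lra.
by rewrite up; lra.
Qed.

Lemma golden_sqr_lt (F : realFieldType) (c : F) :
  0 < c -> c ^+ 2 + c = 1 -> 2 * c ^+ 2 < 1.
Proof. nra. Qed.

(** The order on [algC] is partial, so inequalities are proved in a real field and then read in
    [algR], the subfield of real elements. *)
Lemma golden_sqr_ltC (c : algC) : 0 < c -> c ^+ 2 + c = 1 -> 2 * c ^+ 2 < 1.
Proof.
move=> c0 hc; apply: (@golden_sqr_lt algR (in_algR (gtr0_real c0))) => //.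
exact: val_inj.
Qed.

Lemma negative_windowC (c x s r : algC) :
  c \is Num.real -> r \is Num.real ->
  0 < c -> c ^+ 2 + c = 1 -> 0 < x < 2 -> 0 < s < c ->
  1 <= x * s -> `|r| <= x * s - (x * s)^-1 ->
  2 < x - x^-1 - s + s^-1 + r < 3.
Proof.
move=> cR rR c0 hc /andP [x0 x2] /andP [s0 sc] t1; rewrite invfM => rb.
have [xR sR] := (gtr0_real x0, gtr0_real s0).
have [xiR siR] : x^-1 \is Num.real /\ s^-1 \is Num.real by rewrite !realV.
apply: (@negative_window algR (in_algR cR) (in_algR xR) (in_algR xiR)
  (in_algR sR) (in_algR siR) (in_algR rR)) => //.
- exact: val_inj.
- by apply: val_inj; rewrite /= divff ?gt_eqF.
- by apply: val_inj; rewrite /= divff ?gt_eqF.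
Qed.

Lemma positive_windowC (c x s r : algC) :
  c \is Num.real -> r \is Num.real ->
  0 < c -> c ^+ 2 + c = 1 -> 0 < x < 2 -> 0 < s < c ->
  1 < x * s -> `|r| <= x * s - (x * s)^-1 ->
  0 < x - x^-1 + s - s^-1 + r < 1.
Proof.
move=> cR rR c0 hc /andP [x0 x2] /andP [s0 sc] t1; rewrite invfM => rb.
have [xR sR] := (gtr0_real x0, gtr0_real s0).
have [xiR siR] : x^-1 \is Num.real /\ s^-1 \is Num.real by rewrite !realV.
apply: (@positive_window algR (in_algR cR) (in_algR xR) (in_algR xiR)
  (in_algR sR) (in_algR siR) (in_algR rR)) => //.
- exact: val_inj.
- by apply: val_inj; rewrite /= divff ?gt_eqF.
- by apply: val_inj; rewrite /= divff ?gt_eqF.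
Qed.

Lemma no_int_between_succ (z : algC) (n : int) :
  z \in Num.int -> n%:~R < z < (n + 1)%:~R -> False.
Proof. by move/intrP => [m ->]; rewrite !ltr_int; lia. Qed.

(** * Minimal polynomials and conjugates *)

Lemma irreducible_minCpoly (q : algC) (p : {poly rat}) :
  p \is monic -> (forall r, root (map_poly ratr r) q = (p %| r)) ->
  irreducible_poly p.
Proof.
move=> mon_p dv_p; have nz_p := monic_neq0 mon_p.
have pq0 : root (map_poly ratr p) q by rewrite dv_p.
by apply/(subfx_irreducibleP pq0 nz_p) => r rq nz_r; rewrite dvdp_leq // -dv_p.
Qed.

Lemma separable_minCpoly (q : algC) : separable_poly (minCpoly q).
Proof.
have [p [-> mon_p] dv_p] := minCpolyP q.
have irr : irreducible_poly p by apply: irreducible_minCpoly dv_p.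
rewrite separable_map unlock irreducible_poly_coprime //.
have [p_gt1 _] := irr.
have p'_nz : p^`() != 0.
  (* The top coefficient of the derivative is the degree of the monic p, nonzero in characteristic
     0. *)
  apply/eqP => p'0; have := coef_deriv p (size p).-2.
  have sz : (0 < (size p).-1)%N by rewrite -subn1 subn_gt0.
  rewrite prednK // p'0 coef0 -lead_coefE (monicP mon_p) => /esym/eqP.
  by rewrite pnatr_eq0 gtn_eqF.
by apply/negP => /dvdp_leq -/(_ p'_nz); rewrite leqNgt lt_size_deriv ?monic_neq0.
Qed.

(** The minimal polynomial of z divides the irreducible one of q, and both are monic. *)
Lemma minCpoly_conjugate (q z : algC) :
  root (minCpoly q) z -> minCpoly z = minCpoly q.
Proof.
have [p [-> mon_p] dv_p] := minCpolyP q.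
have [_ irr] : irreducible_poly p by apply: irreducible_minCpoly dv_p.
have sz := size_minCpoly z; have [r [Dr mon_r] dv_r] := minCpolyP z.
rewrite Dr size_map_poly in sz *; rewrite dv_r => rp.
congr (map_poly _ _); apply/eqP; rewrite -eqp_monic //; apply: irr => //.
by rewrite neq_ltn sz orbT.
Qed.

(** * Sums over the conjugates and the unit property *)

(** This is the logarithmic derivative at 0; it makes the sum of inverses an integer once the
    constant coefficient is a unit. *)
Lemma coef1_prod_XsubC (F : fieldType) (rs : seq F) : 0 \notin rs ->
  (\prod_(a <- rs) ('X - a%:P))`_1 =
  - (\prod_(a <- rs) ('X - a%:P))`_0 * \sum_(a <- rs) a^-1.
Proof.
elim: rs => [_|a rs IH]; first by rewrite !big_nil coef1 mulr0.
rewrite inE negb_or eq_sym => /andP [a0 /IH {}IH].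
rewrite !big_cons !mulrBl !coefB !coefXM !coefCM /= IH; field.
exact: a0.
Qed.

Lemma sum_blaschke_le (rs : seq algC) : {in rs, forall a, 0 < `|a| <= 1} ->
  0 < \prod_(a <- rs) `|a| <= 1 /\
  `|\sum_(a <- rs) (a^* - a^-1)| <=
    (\prod_(a <- rs) `|a|)^-1 - \prod_(a <- rs) `|a|.
Proof.
elim: rs => [_|a rs IH ars]; first by rewrite !big_nil normr0 invr1 subrr ltr01 lexx.
have /andP [a0 a1] := ars a (mem_head _ _).
have [|/andP [b0 b1] le_b] := IH; first by move=> z zs; apply: ars; rewrite inE zs orbT.
rewrite !big_cons; set b := \prod_(_ <- _) _ in b0 b1 le_b *.
split; first by rewrite mulr_gt0 // mulr_ile1 // ltW.
have na : `|a^* - a^-1| = `|a|^-1 - `|a|.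
  have az : a != 0 by rewrite -normr_gt0.
  have -> : a^* - a^-1 = (`|a| ^+ 2 - 1) / a by rewrite normCK; field.
  rewrite normrM normfV ler0_norm ?subr_le0 ?expr_le1 ?normr_ge0 //; field.
  by rewrite normr_eq0.
apply: le_trans (ler_normD _ _) _; rewrite na.
apply: le_trans (lerD (lexx _) le_b) _; rewrite -subr_ge0.
(* The defect of superadditivity factors into terms that are nonnegative on ]0, 1]. *)
have -> : (`|a| * b)^-1 - `|a| * b - (`|a|^-1 - `|a| + (b^-1 - b)) =
  (1 - `|a|) * (1 - b) * (1 - `|a| * b) / (`|a| * b).
  by field; rewrite !gt_eqF.
by rewrite divr_ge0 ?mulr_ge0 ?subr_ge0 ?mulr_ile1 // ltW.
Qed.

(** If 0 is a conjugate of q, then q is a conjugate of 0, hence a root of X. *)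
Lemma minCpoly_root0 (q : algC) : root (minCpoly q) 0 -> q = 0.
Proof.
move/minCpoly_conjugate => e; have := root_minCpoly q; rewrite -e.
have [r [-> _] dv_r] := minCpolyP 0 => rq.
have : r %| 'X by rewrite -dv_r map_polyX rootX.
rewrite -(dvdp_map (ratr : {rmorphism rat -> algC})) map_polyX => rX.
have := dvdp_trans (etrans (dvdp_XsubCl _ _) rq) rX.
by rewrite dvdp_XsubCl rootX => /eqP.
Qed.

Lemma pisot_unit_conjugates (q : algC) : pisot q -> q < 2 ->
  exists rs : seq algC,
    [/\ minCpoly q = \prod_(a <- rs) ('X - a%:P), uniq rs,
        `|\prod_(a <- rs) a| = 1, \sum_(a <- rs) a \in Num.int &
        \sum_(a <- rs) a^-1 \in Num.int].
Proof.
move=> [qR qI q1 qconj] q2.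
have [rs] := closed_field_poly_normal (minCpoly q).
rewrite (monicP (minCpoly_monic q)) scale1r => E.
have rsE a : (a \in rs) = root (minCpoly q) a by rewrite E root_prod_XsubC.
have urs : uniq rs by rewrite -separable_prod_XsubC -E separable_minCpoly.
have qrs : q \in rs by rewrite rsE root_minCpoly.
have q0 : 0 < q by apply: lt_trans q1.
have rs0 : 0 \notin rs.
  by rewrite rsE; apply/negP => /minCpoly_root0 e; rewrite e ltxx in q0.
have coef_int i : (minCpoly q)`_i \in Num.int by move/polyOverP: qI.
have c0 := coef0_prod_XsubC rs.
have Nint : \prod_(a <- rs) a \in Num.int.
  have := coef_int 0; rewrite E c0; rewrite -signr_odd.
  by case: odd; rewrite ?expr1 ?expr0 ?mulN1r ?mul1r ?rpredN.
have N1 : `|\prod_(a <- rs) a| = 1.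
  have N0 : \prod_(a <- rs) a != 0.
    by rewrite prodf_seq_neq0; apply/allP => a ars /=; apply: contraNneq rs0 => <-.
  (* Apart from q itself, all factors have modulus below 1, so the product is at most q in
     modulus. *)
  have : `|\prod_(a <- rs) a| < 2.
    rewrite (perm_big _ (perm_to_rem qrs)) big_cons /= normrM gtr0_norm //.
    rewrite normr_prod; apply: le_lt_trans q2; rewrite ger_pMr // big_seq.
    apply: prodr_ile1 => z; rewrite mem_rem_uniq // !inE rsE => /andP [zq zc].
    by rewrite normr_ge0 ltW // qconj.
  have := norm_intr_ge1 Nint N0; case/intrP: Nint => m ->.
  rewrite -intr_norm -[2]/(2%:~R) ltr_int ler1z => m1 m2.
  by rewrite -[1]/(1%:~R); congr (_%:~R); lia.
exists rs; split=> //.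
  rewrite -[\sum_(_ <- _) _]opprK -coefPn_prod_XsubC -?E ?rpredN //.
  by case: (rs) qrs.
have := coef1_prod_XsubC _ _ rs0; rewrite -E => c1.
(* The constant coefficient is its own inverse, so the sum of inverses is a polynomial expression in
   integer coefficients. *)
have C2 : (minCpoly q)`_0 ^+ 2 = 1.
  rewrite -(intr_normK (coef_int 0)) E c0 normrM normrX normrN1.
  by rewrite expr1n mul1r N1 expr1n.
have -> : \sum_(a <- rs) a^-1 = - ((minCpoly q)`_0 * (minCpoly q)`_1).
  by rewrite c1 mulNr mulrN opprK mulrA -expr2 C2 mul1r.
by rewrite rpredN rpredM.
Qed.

(** * Contradiction from a conjugate of modulus below c *)

Theorem theorem5p2 (q : algC) :
  pisot q -> 1 < q < 2 -> (alg_degree q <= 150)%N ->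
  forall q' : algC, galois_conjugate q q' ->
    (sqrtC 5 - 1) / 2 <= `|q'|.
Proof.
move=> pq /andP [q1 q2] _ s sconj.
set c : algC := _ / 2.
have [qR qI _ qconj] := pq.
have q0 : 0 < q by apply: lt_trans q1.
have hc : c ^+ 2 + c = 1.
  have -> : c ^+ 2 + c = (sqrtC 5 ^+ 2 - 1) / 4 by rewrite /c; field.
  by rewrite sqrtCK; field.
have c0 : 0 < c.
  by rewrite divr_gt0 // subr_gt0 -[X in X < _]sqrtC1 ltr_sqrtC ?nnegrE ?ler0n ?ltr1n.
have cR := gtr0_real c0.
have c1 : c < 1 by rewrite -hc ltrDr exprn_gt0.
rewrite real_leNgt //; apply/negP => sc.
have s1 := lt_trans sc c1.
have sq : s != q by apply: contraTneq s1 => ->; rewrite gtr0_norm // lt_gtF.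
have [rs [E urs N1 Sint Vint]] := pisot_unit_conjugates _ pq q2.
have rsE a : (a \in rs) = root (minCpoly q) a by rewrite E root_prod_XsubC.
have rsP : perm_eq rs [:: q, s & rem s (rem q rs)].
  have qrs : q \in rs by rewrite rsE root_minCpoly.
  have srs : s \in rem q rs by rewrite mem_rem_uniq // !inE sq rsE.
  by apply: perm_trans (perm_to_rem qrs) _; rewrite perm_cons perm_to_rem.
set rest := rem s _ in rsP.
have uall : uniq [:: q, s & rest] by rewrite -(perm_uniq rsP).
have norm01 a : a \in rest -> 0 < `|a| < 1.
  move=> ar; have aq : a != q.
    by apply: contraTneq uall => <-; rewrite /= inE ar orbT.
  have aroot : root (minCpoly q) a by rewrite -rsE (perm_mem rsP) !inE ar !orbT.
  rewrite qconj // normr_gt0 andbT; apply: contraTneq aroot => ->.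
  by apply/negP => /minCpoly_root0 e; rewrite e ltxx in q0.
have s0 : 0 < `|s|.
  rewrite normr_gt0; apply: contraTneq sconj => ->.
  by apply/negP => /minCpoly_root0 e; rewrite e ltxx in q0.
have [|] := @sum_blaschke_le rest.
  by move=> a /norm01 /andP [-> /ltW].
set b := \prod_(_ <- _) _ => /andP [b0 b1] le_b.
have qsb : q * `|s| * b = 1.
  move: N1; rewrite (perm_big _ rsP) !big_cons /= !normrM gtr0_norm //.
  by rewrite normr_prod mulrA.
(* All factors of b are at most 1. This bounds b by |s| when the conjugate of a nonreal s is a
   factor, and excludes every factor when b = 1. *)
have le_b_mem a : a \in rest -> b <= `|a|.
  move=> ar; rewrite /b (perm_big _ (perm_to_rem ar)) big_cons /= ger_pMr.
    rewrite big_seq; apply: prodr_ile1 => z /mem_rem /norm01 /andP [z0 z1].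
    by rewrite !ltW.
  by have /andP [] := norm01 a ar.
have bE : b = (q * `|s|)^-1.
  have nz : q * `|s| != 0 by rewrite gt_eqF // mulr_gt0.
  by apply: (mulfI nz); rewrite qsb divff.
have t1 : 1 <= q * `|s| by rewrite -qsb ger_pMr // mulr_gt0.
have sreal : s \is Num.real.
  apply/CrealP/eqP; apply: contraTT isT => sJ.
  have sJrest : s^* \in rest.
    have : s^* \in rs.
      rewrite rsE -(minCpoly_conjugate _ _ sconj).
      by rewrite -(minCpoly_aut (Num.conj : {rmorphism algC -> algC})) root_minCpoly.
    rewrite (perm_mem rsP) !inE (negPf sJ) /= => /orP [/eqP sJq|] //.
    by case/eqP: sq; rewrite -[s]conjCK sJq conj_Creal.
  have := le_b_mem _ sJrest; rewrite norm_conjC => bs.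
  have : q * `|s| * b < 2 * c ^+ 2.
    rewrite expr2 mulrA ltr_pM ?(ltW b0) ?(mulr_ge0 (ltW q0)) //.
      by rewrite ltr_pM // ltW.
    exact: le_lt_trans sc.
  by rewrite qsb => lt1; have := lt_trans lt1 (golden_sqr_ltC _ c0 hc); rewrite ltxx.
rewrite bE invrK in le_b.
set r := \sum_(_ <- _) _ in le_b.
have Tint : q - q^-1 + (s - s^-1) + r \in Num.int.
  (* The reals q and s are fixed by conjugation, and so is the integer trace. *)
  have -> : q - q^-1 + (s - s^-1) + r = (\sum_(a <- rs) a)^* - \sum_(a <- rs) a^-1.
    rewrite rmorph_sum -sumrB (perm_big _ rsP) !big_cons /= !conj_Creal //.
    by rewrite addrA.
  by rewrite conj_intr // rpredB.
have rR : r \is Num.real.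
  have -> : r = q - q^-1 + (s - s^-1) + r - (q - q^-1 + (s - s^-1)) by ring.
  apply: realB; first exact: Rreal_int.
  by rewrite realD ?realB ?realV.
have q02 : 0 < q < 2 by rewrite q0.
have s0c : 0 < `|s| < c by rewrite s0.
have [s_neg|s_pos] := real_ltP sreal (real0 _); last first.
  rewrite ger0_norm // in s0 s0c s1 t1 qsb le_b.
  move: t1; rewrite le_eqVlt => /predU1P [t1|t1].
    have rest0 : rest = [::].
      move: qsb le_b_mem norm01; rewrite -t1 mul1r => ->.
      case: (rest) => // a l le1 lt1; have := le1 a (mem_head _ _).
      by have /andP [_ /lt_geF ->] := lt1 a (mem_head _ _).
    have := Sint; rewrite (perm_big _ rsP) !big_cons /= rest0 big_nil addr0 => qsI.
    apply: (no_int_between_succ _ 2 qsI); apply/andP; split.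
      (* Since q s = 1, this product equals q + s - 2. *)
      have : 0 < (q - 1) * (1 - s) by rewrite mulr_gt0 ?subr_gt0.
      have -> : (q - 1) * (1 - s) = q + s - (q * s + 1) by ring.
      by rewrite -t1 subr_gt0.
    by rewrite intrD ltrD.
  have := positive_windowC _ _ _ _ cR rR c0 hc q02 s0c t1 le_b.
  by rewrite -[_ + s - _]addrA; apply: (no_int_between_succ _ 0 Tint).
rewrite ltr0_norm // in s0c t1 le_b.
have := negative_windowC _ _ _ _ cR rR c0 hc q02 s0c t1 le_b.
rewrite invrN opprK -[_ + s - _]addrA; apply: (no_int_between_succ _ 2 Tint).
Qed.
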